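(* Let $(\Omega,\mathcal{A},P)$ be a probability space, $\mathcal{F}\subseteq\mathcal{A}$ a $\sigma$-algebra, $a>0$ a constant, and $A\in\mathcal{A}$ an event with $0<P[A]<1$. Suppose $Y$ is the random variable given by $Y=a\,P[A\mid\mathcal{F}]$. Then a random variable $Y'$ has the $Y$-size biased distribution if the distribution of $Y'$ is the conditional distribution of $Y$ given the event $A$, i.e. if $\mathcal{L}(Y')=\mathcal{L}(Y\mid A)$.
   Context: For a nonnegative random variable $Y$ with mean $\mu=\mathbb{E}Y\in(0,\infty)$, a random variable $Y'$ has the $Y$-size biased distribution if $\mathbb{E}[Yg(Y)]=\mu\,\mathbb{E}[g(Y')]$ for all bounded continuous functions $g:\mathbb{R}\to\mathbb{R}$. $\mathcal{L}(\cdot)$ denotes the distribution of a random variable. *)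

(* Defs.v *)
From HB Require Import structures.
From mathcomp Require Import all_boot all_order all_algebra.
From mathcomp Require Import all_classical all_reals all_analysis.

Set Implicit Arguments.
Unset Strict Implicit.
Unset Printing Implicit Defensive.
Import Order.TTheory GRing.Theory Num.Theory.
Import numFieldNormedType.Exports.
Local Open Scope classical_set_scope.
Local Open Scope ring_scope.
Local Open Scope ereal_scope.

Definition sub_sigma_algebra_of (d : measure_display) (T : measurableType d)
    (F : set (set T)) : Prop :=
  sigma_algebra setT F /\ F `<=` measurable.

(* [Z] is a version of E[X | F]. *)
Definition is_cond_expectation (d : measure_display) (T : measurableType d)
    (R : realType) (P : probability T R) (F : set (set T)) (X Z : T -> R) : Prop :=
  [/\ (forall B : set R, measurable B -> F (Z @^-1` B)),
      P.-integrable setT (EFin \o Z) &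
      forall C : set T, F C ->
        \int[P]_(w in C) (Z w)%:E = \int[P]_(w in C) (X w)%:E].

(* [Z] is a version of P[A | F] = E[1_A | F]. *)
Definition is_cond_probability (d : measure_display) (T : measurableType d)
    (R : realType) (P : probability T R) (F : set (set T)) (A : set T)
    (Z : T -> R) : Prop :=
  is_cond_expectation P F (\1_A : T -> R) Z.

(* The law L(Y | A); only meaningful when P A is nonzero. *)
Definition cond_distribution (d : measure_display) (T : measurableType d)
    (R : realType) (P : probability T R) (Y : {RV P >-> R}) (A : set T) :
    set R -> \bar R :=
  fun B => P (A `&` Y @^-1` B) / P A.

(* [Y'] has the [Y]-size biased distribution; [Y'] may live on a different
   probability space.  Nonnegativity is almost sure because
   [Y] may be a version of a conditional probability, only determined up to a
   null set. *)
Definition size_biased (d d' : measure_display) (T : measurableType d)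
    (T' : measurableType d') (R : realType) (P : probability T R)
    (P' : probability T' R) (Y : {RV P >-> R}) (Y' : {RV P' >-> R}) : Prop :=
  [/\ {ae P, forall w, (0 <= Y w)%R},
      0 < 'E_P[Y] < +oo &
      forall g : R -> R, continuous g -> bounded_fun g ->
        'E_P[fun w => (Y w * g (Y w))%R] = 'E_P[Y] * 'E_P'[g \o Y']].

(* Main.v *)
Require Import Defs.
From HB Require Import structures.
From mathcomp Require Import all_boot all_order all_algebra.
From mathcomp Require Import all_classical all_reals all_analysis.
From mathcomp Require Import measurable_realfun.
Import Order.TTheory GRing.Theory Num.Theory.
Import numFieldNormedType.Exports.
Local Open Scope classical_set_scope.
Local Open Scope ring_scope.
Local Open Scope ereal_scope.

(** Why the theorem holds.  For a Borel set [B], the event [Y \in B] belongs to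
    [F] up to a null set, because [Y = a * Z] almost surely and [Z] is
    [F]-measurable.  The defining property of [P[A | F]] on that event gives
      [E[Y; Y \in B] = a * P (A and Y \in B)]
    ([cond_expectation_integral_preimage]).  Taking [B] to be the whole line
    gives [E[Y] = a * P A], and dividing shows that [L(Y | A)], which is the law
    of [Y'], satisfies [E[Y; Y \in B] = E[Y] * P (Y' \in B)].

    This is the size-bias identity for the indicator of [B], and indicators
    suffice ([size_biased_indicator]): the identity says that the law of [Y']
    has density [x / E[Y]] with respect to the law of [Y].  Integrating a
    bounded [g] against this density is the size-bias identity for [g], and
    since a density of a measure is almost everywhere nonnegative, [Y >= 0]
    almost surely comes with it. *)

Lemma density_dominates (d : measure_display) (T : measurableType d)
    (R : realType) (nu mu : {finite_measure set T -> \bar R})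
    (f : T -> \bar R) :
  mu.-integrable setT f ->
  (forall B, measurable B -> nu B = \int[mu]_(x in B) f x) ->
  nu `<< mu.
Proof.
move=> intf nuE; apply/null_content_dominatesP => B mB muB0.
rewrite nuE//; apply: null_set_integral => //.
by apply: measurable_int; exact: integrableS intf.
Qed.

Lemma density_ae_unique (d : measure_display) (T : measurableType d)
    (R : realType) (nu mu : {finite_measure set T -> \bar R})
    (f h : T -> \bar R) :
  mu.-integrable setT f -> mu.-integrable setT h ->
  (forall B, measurable B -> nu B = \int[mu]_(x in B) f x) ->
  (forall B, measurable B -> nu B = \int[mu]_(x in B) h x) ->
  ae_eq mu setT f h.
Proof.
move=> intf inth nuf nuh; apply: integral_ae_eq => //.
  exact: measurable_int inth.
by move=> B _ mB; rewrite -nuf// -nuh.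
Qed.

(** A density agrees almost everywhere with the Radon-Nikodym derivative built
    for measures, which is nonnegative. *)
Lemma density_ae_ge0 (d : measure_display) (T : measurableType d)
    (R : realType) (nu mu : {finite_measure set T -> \bar R})
    (f : T -> \bar R) :
  mu.-integrable setT f ->
  (forall B, measurable B -> nu B = \int[mu]_(x in B) f x) ->
  {ae mu, forall x, 0 <= f x}.
Proof.
move=> intf nuE; have numu := density_dominates _ _ _ _ _ _ intf nuE.
have := density_ae_unique _ _ _ _ _ _ _ intf
  (Radon_Nikodym_SigmaFinite.f_integrable numu) nuE
  (Radon_Nikodym_SigmaFinite.f_integral numu).
by apply: filterS => x /(_ I) ->; exact: Radon_Nikodym_SigmaFinite.f_ge0.
Qed.

Lemma density_change_of_variables (d : measure_display)
    (T : measurableType d) (R : realType)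
    (nu mu : {finite_measure set T -> \bar R}) (f g : T -> \bar R) :
  mu.-integrable setT f ->
  (forall B, measurable B -> nu B = \int[mu]_(x in B) f x) ->
  nu.-integrable setT g ->
  \int[mu]_x (g x * f x) = \int[nu]_x g x.
Proof.
move=> intf nuE intg; have numu := density_dominates _ _ _ _ _ _ intf nuE.
rewrite -(Radon_Nikodym_change_of_variables numu)//.
have mg : measurable_fun setT g := measurable_int _ intg.
apply: ae_eq_integral => //.
- by apply: emeasurable_funM => //; exact: measurable_int intf.
- exact: emeasurable_funM.
- apply: ae_eqe_mul2l; apply: (density_ae_unique _ _ _ nu) => //.
    exact: Radon_Nikodym_integrable.
  by move=> B mB; rewrite -Radon_Nikodym_integral.
Qed.

(** Indicators of Borel sets are not continuous, so they are not themselves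
    test functions of the definition; they are enough because they identify
    [x / E[Y]] as the density of the law of [Y'] with respect to that of
    [Y]. *)
Lemma size_biased_indicator (d d' : measure_display) (T : measurableType d)
    (T' : measurableType d') (R : realType) (P : probability T R)
    (P' : probability T' R) (Y : {RV P >-> R}) (Y' : {RV P' >-> R}) :
  P.-integrable setT (EFin \o Y) -> 0 < 'E_P[Y] ->
  (forall B : set R, measurable B ->
     \int[P]_(w in Y @^-1` B) (Y w)%:E = 'E_P[Y] * distribution P' Y' B) ->
  size_biased Y Y'.
Proof.
move=> intY EY0 EYB.
have EYfin : 'E_P[Y] \is a fin_num.
  by rewrite unlock; exact: integrable_fin_num.
pose m := fine 'E_P[Y].
have EYE : 'E_P[Y] = m%:E by rewrite fineK.
have m0 : (0 < m)%R by rewrite -lte_fin -EYE.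
pose f (x : R) := (m^-1)%:E * x%:E.
have intid : (distribution P Y).-integrable setT (EFin : R -> \bar R).
  by apply: (integrable_pushforward (measurable_funP Y)).
have intf : (distribution P Y).-integrable setT f by exact: integrableZl.
have fdensity B : measurable B ->
    distribution P' Y' B = \int[distribution P Y]_(x in B) f x.
  move=> mB; rewrite /f integralZl//; last exact: integrableS intid.
  rewrite (integral_pushforward (measurable_funP Y))//.
    by rewrite /= EYB// EYE muleA -EFinM mulVf ?gt_eqF// mul1e.
  by apply: (integrableS measurableT _ _ intY) => //; exact: measurable_funPTI.
split.
- have [N [mN N0 subN]] := density_ae_ge0 _ _ _
    (distribution P' Y') (distribution P Y) f intf fdensity.
  exists (Y @^-1` N); split => //; first exact: measurable_funPTI.
  move=> w /= Yw; apply: subN => /= fYw; apply: Yw.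
  by move: fYw; rewrite /f -EFinM lee_fin pmulr_rge0// invr_gt0.
- by rewrite EY0 EYE ltry.
- move=> g cg bg.
  have mg := continuous_measurable_fun cg.
  have bgo (S : Type) (X : S -> R) : bounded_fun (g \o X).
    have [M [Mreal gM]] := bg; exists M; split => // K MK x _.
    exact: gM.
  have intg : (distribution P' Y').-integrable setT (EFin \o g).
    apply: measurable_bounded_integrable => //.
    by rewrite (le_lt_trans (probability_le1 _ _))// ltry.
  have intgY : P.-integrable setT (fun w => (g (Y w))%:E * f (Y w)).
    apply: (@integrableMr _ _ _ _ _ measurableT (g \o Y)).
    - exact: measurableT_comp.
    - exact: bgo.
    - exact: integrableZl.
  have intgY' : P'.-integrable setT (EFin \o (g \o Y')).
    apply: measurable_bounded_integrable => //.
    - by rewrite (le_lt_trans (probability_le1 _ _))// ltry.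
    - exact: measurableT_comp.
    - exact: bgo.
  have mgR := measurable_int _ intg.
  have := density_change_of_variables _ _ _
    (distribution P' Y') (distribution P Y) f _ intf fdensity intg.
  rewrite [RHS]integral_distribution//.
  rewrite [LHS]integral_distribution//=; last first.
    by apply: emeasurable_funM => //; exact: measurable_int intf.
  rewrite EYE unlock => <-.
  rewrite -integralZl//.
  by apply: eq_integral => w _; rewrite /f -!EFinM mulrCA mulVKf ?gt_eqF// mulrC.
Qed.

Lemma integral_ae_eq_set (d : measure_display) (T : measurableType d)
    (R : realType) (mu : {measure set T -> \bar R}) (D E : set T)
    (f : T -> \bar R) :
  measurable D -> measurable E -> measurable_fun setT f ->
  {ae mu, forall x, D x <-> E x} ->
  \int[mu]_(x in D) f x = \int[mu]_(x in E) f x.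
Proof.
move=> mD mE mf DE; rewrite integral_mkcond [RHS]integral_mkcond.
apply: ae_eq_integral => //.
- by apply/(measurable_restrictT _ _).1 => //; exact: measurable_funTS.
- by apply/(measurable_restrictT _ _).1 => //; exact: measurable_funTS.
- apply: filterS DE => x DE _.
  by rewrite /patch; congr (if _ then _ else _); apply: asbool_equiv_eq.
Qed.

Lemma ae_eq_integrable (d : measure_display) (T : measurableType d)
    (R : realType) (mu : {measure set T -> \bar R}) (f g : T -> \bar R) :
  measurable_fun setT g -> ae_eq mu setT f g ->
  mu.-integrable setT f -> mu.-integrable setT g.
Proof.
move=> mg fg /integrableP[mf foo]; apply/integrableP; split => //.
have <-// : \int[mu]_x `|f x| = \int[mu]_x `|g x|.
apply: ae_eq_integral => //.
- exact: measurableT_comp.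
- exact: measurableT_comp.
- by apply: filterS fg => x + xT /= => /(_ xT) ->.
Qed.

(** The preimages under [Y] need not belong to [F], since [Y] is only almost
    surely equal to [a * Z]: the integrals are moved to the preimages under
    [a * Z], which do, and back. *)
Lemma cond_expectation_integral_preimage (d : measure_display)
    (T : measurableType d) (R : realType) (P : probability T R)
    (F : set (set T)) (X Z : T -> R) (a : R) (Y : {RV P >-> R}) (B : set R) :
  sub_sigma_algebra_of F -> measurable_fun setT X ->
  is_cond_expectation P F X Z ->
  {ae P, forall w, Y w = (a * Z w)%R} -> measurable B ->
  \int[P]_(w in Y @^-1` B) (Y w)%:E =
  a%:E * \int[P]_(w in Y @^-1` B) (X w)%:E.
Proof.
move=> [_ Fmeas] mX [ZF intZ Zint] YaZ mB.
pose D := (fun w => a * Z w)%R @^-1` B.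
have FD : F D.
  apply: (ZF ((fun x => a * x)%R @^-1` B)).
  rewrite -[_ @^-1` _]setTI.
  have mmul : measurable_fun setT (fun x : R => a * x)%R.
    exact: measurable_funM.
  exact: mmul.
have mD := Fmeas _ FD.
have mYB : measurable (Y @^-1` B) by exact: measurable_funPTI.
have YD : {ae P, forall w, (Y @^-1` B) w <-> D w}.
  by apply: filterS YaZ => w; rewrite /D /preimage /= => ->.
have mZ : measurable_fun setT (EFin \o Z) := measurable_int _ intZ.
rewrite (integral_ae_eq_set _ _ _ _ _ D)//; last exact/measurable_EFinP.
transitivity (\int[P]_(w in D) (a%:E * (Z w)%:E)).
  apply: ae_eq_integral => //.
  - exact/measurable_funTS/measurable_EFinP.
  - exact/measurable_funTS/emeasurable_funM.
  - by apply: filterS YaZ => w /= -> _.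
rewrite integralZl//; last exact: integrableS intZ.
congr (_ * _); rewrite Zint// -(integral_ae_eq_set _ _ _ _ (Y @^-1` B))//.
exact/measurable_EFinP.
Qed.

Theorem lemma4p1 (d d' : measure_display) (T : measurableType d)
    (T' : measurableType d') (R : realType) (P : probability T R)
    (P' : probability T' R) (F : set (set T)) (hF : sub_sigma_algebra_of F)
    (a : R) (ha : (0 < a)%R) (A : set T) (mA : measurable A)
    (hA : 0 < P A < 1) (Z : T -> R) (hZ : is_cond_probability P F A Z)
    (Y : {RV P >-> R}) (hY : {ae P, forall w, Y w = (a * Z w)%R})
    (Y' : {RV P' >-> R})
    (hY' : forall B : set R, measurable B ->
       distribution P' Y' B = cond_distribution Y A B) :
  size_biased Y Y'.
Proof.
have EYB B : measurable B ->
    \int[P]_(w in Y @^-1` B) (Y w)%:E = a%:E * P (A `&` Y @^-1` B).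
  move=> mB; have mYB : measurable (Y @^-1` B) by exact: measurable_funPTI.
  by rewrite (cond_expectation_integral_preimage _ _ _ _ _ _ _ _ _ _
    hF _ hZ hY)// integral_indic.
have PAfin : P A \is a fin_num by exact: fin_num_measure.
have /andP[PA0 _] := hA.
have EY : 'E_P[Y] = a%:E * P A.
  by rewrite unlock -[X in P X]setIT -(EYB setT).
have [_ intZ _] := hZ.
apply: size_biased_indicator.
- apply: (ae_eq_integrable _ _ _ _ (fun w => a%:E * (Z w)%:E)).
  + exact/measurable_EFinP.
  + by apply: filterS hY => w /= -> _.
  + exact: integrableZl.
- by rewrite EY mule_gt0.
- move=> B mB; rewrite EYB// hY'// EY /cond_distribution -muleA.
  by congr (_ * _); rewrite muleCA divee ?mule1// gt_eqF.
Qed.
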